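(* Let $G$ be a discrete abelian group, $S=G\setminus\{0\}$, and let $\mu_0,\mu_n\in\mathcal M$ $(n\in\mathbb N)$ be absolutely continuous with respect to $\lambda$. If $\mathrm{m}\text{-}\lim\mu_n=\mu_0$, then $$\limsup_{n\to\infty}d_p(\mu_n;S)\le d_p(\mu_0;S)$$ for all $p\in[1,\infty)$.
   Context: $G$ is a discrete abelian group (written additively, $G\ne\{0\}$), $\Gamma$ is its compact dual group with normalized Haar measure $\lambda$, and for $x\in G$, $e_x:\Gamma\to\mathbb C$ is the character of $\Gamma$ generated by $x$. $\mathcal M$ is the set of all non-zero finite non-negative regular Borel measures on $\Gamma$. For $S\subseteq G\setminus\{0\}$ non-empty, $\mathcal T(S)$ is the complex linear space of all finite sums $\sum_j a_je_{x_j}$, $a_j\in\mathbb C$, $x_j\in S$, and $d_p(\mu;S):=\inf\{\int|1-\tau|^p\,d\mu:\tau\in\mathcal T(S)\}$. $\mathrm{m}\text{-}\lim\mu_n=\mu_0$ (convergence in measure) means: for some (equivalently, every) $\nu\in\mathcal M$ with $\mu_k\ll\nu$ for all $k\in\mathbb N_0$, the Radon-Nikodym derivatives $\frac{d\mu_n}{d\nu}$ converge to $\frac{d\mu_0}{d\nu}$ in measure $\nu$. *)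

(* Defs.v *)
From HB Require Import structures.
From mathcomp Require Import all_boot all_order all_algebra.
From mathcomp Require Import complex.
From mathcomp Require Import all_classical all_reals all_analysis.

Set Implicit Arguments.
Unset Strict Implicit.
Unset Printing Implicit Defensive.
Import Order.TTheory GRing.Theory Num.Theory.
Import numFieldNormedType.Exports.
Import ComplexField.Normc.
Local Open Scope classical_set_scope.
Local Open Scope ring_scope.
Local Open Scope charge_scope.

(* The library puts the norm topology of [R[i]] on the alias [R[i]^o] only. *)
HB.instance Definition _ (R : realType) := PseudoMetric.copy R[i] R[i]^o.

(* [normc] is the real-valued modulus; the norm of [R[i]] is [R[i]]-valued. *)
Definition is_character (R : realType) (G : zmodType) (f : G -> R[i]) : Prop :=
  (forall x, normc (f x) = 1) /\ (forall x y, f (x + y) = f x * f y).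

(* G carries no topology: being discrete, all its characters are continuous. *)
Record dual (R : realType) (G : zmodType) := Dual {
  dual_fun :> G -> R[i];
  dual_funP : `[< is_character dual_fun >] }.

HB.instance Definition _ (R : realType) (G : zmodType) :=
  [isSub for @dual_fun R G].
HB.instance Definition _ (R : realType) (G : zmodType) :=
  [Choice of dual R G by <:].

Section dual_group.
Variables (R : realType) (G : zmodType).
Implicit Types f g h : dual R G.

Lemma dual_character f : is_character f.
Proof. exact/asboolP/dual_funP. Qed.

Lemma dual_ext f g : dual_fun f =1 dual_fun g -> f = g.
Proof. by move=> fg; apply: val_inj; apply/funext. Qed.

Fact is_character1 : is_character (fun _ : G => 1 : R[i]).
Proof. by split=> [x|x y]; rewrite ?mulr1// normc1. Qed.

Fact is_characterM f g : is_character (fun x => f x * g x).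
Proof.
have [f1 fD] := dual_character f; have [g1 gD] := dual_character g.
by split=> [x|x y]; [rewrite normcM f1 g1 mulr1 | rewrite fD gD mulrACA].
Qed.

Fact is_characterV f : is_character (fun x => (f x)^-1).
Proof.
have [f1 fD] := dual_character f.
by split=> [x|x y]; [rewrite normcV f1 invr1 | rewrite fD invfM].
Qed.

Definition dual_one : dual R G := Dual (asboolT is_character1).
Definition dual_mul f g : dual R G := Dual (asboolT (is_characterM f g)).
Definition dual_inv f : dual R G := Dual (asboolT (is_characterV f)).

Fact dual_mulA : associative dual_mul.
Proof. by move=> f g h; apply: dual_ext => x /=; rewrite mulrA. Qed.

Fact dual_mulC : commutative dual_mul.
Proof. by move=> f g; apply: dual_ext => x /=; rewrite mulrC. Qed.

Fact dual_mul1 : left_id dual_one dual_mul.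
Proof. by move=> f; apply: dual_ext => x /=; rewrite mul1r. Qed.

Fact dual_mulV : left_inverse dual_one dual_inv dual_mul.
Proof.
move=> f; apply: dual_ext => x /=; rewrite mulVf//.
apply/eqP => fx0; have [/(_ x)+ _] := dual_character f.
by rewrite fx0 normc0 => /esym/eqP; rewrite oner_eq0.
Qed.

Fact dual_1mul : right_id dual_one dual_mul.
Proof. by move=> f; rewrite dual_mulC dual_mul1. Qed.

Fact dual_Vmul : right_inverse dual_one dual_inv dual_mul.
Proof. by move=> f; rewrite dual_mulC dual_mulV. Qed.

HB.instance Definition _ := isGroup.Build (dual R G)
  dual_mulA dual_mul1 dual_1mul dual_mulV dual_Vmul.

HB.instance Definition _ := isPointed.Build (dual R G) dual_one.

(* topology of pointwise convergence *)
HB.instance Definition _ := Topological.copy (dual R G)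
  (initial_topology (@dual_fun R G : dual R G -> {ptws G -> R[i]})).

(* Borel sigma-algebra *)
HB.instance Definition _ := Measurable.copy (dual R G)
  (g_sigma_algebraType (@open (dual R G))).

End dual_group.

Definition regular_measure (R : realType) (G : zmodType)
    (mu : set (dual R G) -> \bar R) : Prop :=
  forall A : set (dual R G), measurable A ->
    mu A = ereal_inf [set mu U | U in [set U | open U /\ A `<=` U]] /\
    mu A = ereal_sup [set mu K | K in [set K | compact K /\ K `<=` A]].

Definition normalized_haar (R : realType) (G : zmodType)
    (lambda : {finite_measure set (dual R G) -> \bar R}) : Prop :=
  [/\ regular_measure lambda, lambda [set: dual R G] = 1%E &
      forall (g : dual R G) (A : set (dual R G)), measurable A ->
        lambda [set (g * h)%g | h in A] = lambda A].

Definition inM (R : realType) (G : zmodType)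
    (mu : {finite_measure set (dual R G) -> \bar R}) : Prop :=
  regular_measure mu /\ mu [set: dual R G] <> 0%E.

Definition echar (R : realType) (G : zmodType) (x : G) : dual R G -> R[i] :=
  fun g => g x.

Definition trig_poly (R : realType) (G : zmodType) (S : set G)
    : set (dual R G -> R[i]) :=
  [set tau | exists (n : nat) (a : 'I_n -> R[i]) (x : 'I_n -> G),
     (forall j, S (x j)) /\ tau = fun g => \sum_(j < n) a j * echar (x j) g].

Definition dp (R : realType) (G : zmodType) (p : R)
    (mu : {finite_measure set (dual R G) -> \bar R}) (S : set G) : \bar R :=
  ereal_inf [set (\int[mu]_g ((normc (1 - tau g)) `^ p)%:E)%E |
             tau in trig_poly S].

Definition cvg_in_measure d (T : measurableType d) (R : realType)
    (nu : {finite_measure set T -> \bar R}) (f : nat -> T -> \bar R)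
    (f0 : T -> \bar R) : Prop :=
  forall e : R, 0 < e ->
    nu [set t | (e%:E <= `|f n t - f0 t|)%E] @[n --> \oo] --> 0%E.

Definition mlim (R : realType) (G : zmodType)
    (mu : nat -> {finite_measure set (dual R G) -> \bar R})
    (mu0 : {finite_measure set (dual R G) -> \bar R}) : Prop :=
  exists nu : {finite_measure set (dual R G) -> \bar R},
    [/\ inM nu, mu0 `<< nu, (forall n, mu n `<< nu) &
        cvg_in_measure nu
          (fun n => 'd (charge_of_finite_measure (mu n)) '/d nu)
          ('d (charge_of_finite_measure mu0) '/d nu)].

(* Main.v *)
Require Import Defs.
From HB Require Import structures.
From mathcomp Require Import all_boot all_order all_algebra.
From mathcomp Require Import finmap complex.
From mathcomp Require Import all_classical all_reals all_analysis.
From mathcomp Require Import measurable_realfun ring lra.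
Import Order.TTheory GRing.Theory Num.Theory.
Import numFieldNormedType.Exports.
Import ComplexField.Normc.
Set Implicit Arguments.
Unset Strict Implicit.
Unset Printing Implicit Defensive.
Local Open Scope classical_set_scope.
Local Open Scope ring_scope.

(** Fix [tau] in [T(S)], S the set of nonzero elements, and put
    [D = \int |1 - tau|^p dmu0]. It is enough to produce, for every [e > 0] and
    all large [n], an admissible competitor for [mu_n] whose integral is at most
    [D + e]. The function [1 - tau] itself will not do: convergence in measure
    lets [mu_n] put a lot of mass, even unboundedly much, on sets that shrink to
    nothing. So [1 - tau] is cut off outside a set [A_n] on which the density of
    [mu_n] is at most that of [mu0] plus a small constant. On [A_n] the integral
    against [mu_n] is nearly at most [D] (truncated_integral_le), and the complement
    of [A_n] becomes negligible for Haar measure.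

    The function [(1 - tau) 1_{A_n}] is no longer of the form [1 - tau'], but it is
    bounded and its Haar mean tends to 1. For any trigonometric polynomial [P] with
    nonzero mean [a], [P / a] has mean 1, hence is [1 - tau'] with [tau'] in
    [T(S)]. Replacing the indicator of [A_n] by a trigonometric polynomial [Q] that
    is close to it in [L^1(mu_n)] and [L^1(lambda)] and takes values in [[0, 1]]
    gives such a [P = (1 - tau) Q] (dp_le_truncation). Because [Q^p <= Q], closeness
    in [L^1] is all that the p-th powers require, so all [p >= 1] are treated alike.

    Three ingredients support this. Such [Q] exist for arbitrary Borel sets and
    regular measures (indic_real_trig); here explicit polynomials converging to
    the sign function turn basic open sets into bounded limits of trigonometric
    polynomials, and regularity with compactness does the rest. The mean of a
    trigonometric polynomial is its constant term (trig_poly_mean0), which is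
    invariance of Haar measure as long as each nonzero [x] is moved away from 1 by
    some character; if some nonzero [x] is sent to 1 by all characters, then 1 lies
    in [T(S)] and every [d_p] is 0. Finally, the measure [nu] in which the
    densities converge may fail to dominate [lambda]: the part of [lambda] singular
    to [nu] sits on a [nu]-null set, which no [mu_n] charges and which can
    therefore be kept inside [A_n] (abs_continuous_off_null_set). *)

(** * The algebra of trigonometric polynomials *)

Section trig_algebra.
Variables (R : realType) (G : zmodType).
Implicit Types (S : set G) (P Q tau : dual R G -> R[i]) (u v : dual R G -> R).

Lemma echarD (x y : G) (g : dual R G) :
  echar (x + y) g = echar x g * echar y g.
Proof. by have [_ gD] := dual_character g; exact: gD. Qed.

Lemma normc_echar (x : G) (g : dual R G) : normc (echar x g) = 1.
Proof. by have [g1 _] := dual_character g; exact: g1. Qed.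

Lemma normc_ge0 (z : R[i]) : 0 <= normc z.
Proof. by case: z => a b; exact: sqrtr_ge0. Qed.

Lemma echar_neq0 (x : G) (g : dual R G) : echar x g != 0.
Proof.
apply/eqP => /(congr1 (@normc R)); rewrite normc_echar normc0 => /eqP.
by rewrite oner_eq0.
Qed.

Lemma echar0 (g : dual R G) : echar 0 g = 1.
Proof.
by apply: (mulfI (echar_neq0 0 g)); rewrite -echarD addr0 mulr1.
Qed.

Lemma echarN (x : G) (g : dual R G) : echar (- x) g = conjc (echar x g).
Proof.
have eN : echar (- x) g * echar x g = 1 by rewrite -echarD addNr echar0.
apply: (mulIf (echar_neq0 x g)); rewrite eN mulrC -sqr_normc.
by rewrite -[ `|_|]/((normc _)%:C%C) normc_echar expr1n.
Qed.

Lemma trig_poly_sub S S' P : S `<=` S' -> trig_poly S P -> trig_poly S' P.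
Proof.
by move=> SS' [n [a [x [Sx ->]]]]; exists n, a, x; split=> // j; exact: SS'.
Qed.

Lemma trig_poly0 S : trig_poly S (fun=> 0 : R[i]).
Proof.
exists 0, (fun=> 0), (fun=> 0); split=> [[]//|].
by apply/funext => g; rewrite big_ord0.
Qed.

Lemma trig_polyD S P Q : trig_poly S P -> trig_poly S Q ->
  trig_poly S (fun g => P g + Q g).
Proof.
move=> [m [a [x [Sx ->]]]] [n [b [y [Sy ->]]]].
exists (m + n)%N.
exists (fun j : 'I_(m + n) => match fintype.split j with inl i => a i | inr i => b i end).
exists (fun j : 'I_(m + n) => match fintype.split j with inl i => x i | inr i => y i end).
split=> [j|]; first by case: fintype.split.
apply/funext => g; rewrite big_split_ord/=; congr (_ + _).
  by apply: eq_bigr => i _; rewrite -[lshift n i]/(unsplit (inl i)) unsplitK.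
by apply: eq_bigr => i _; rewrite -[rshift m i]/(unsplit (inr i)) unsplitK.
Qed.

Lemma trig_polyZ S P (c : R[i]) : trig_poly S P ->
  trig_poly S (fun g => c * P g).
Proof.
move=> [n [a [x [Sx ->]]]]; exists n, (fun j => c * a j), x; split=> //.
by apply/funext => g; rewrite mulr_sumr; apply: eq_bigr => j _; rewrite mulrA.
Qed.

Lemma trig_poly_monomial S (c : R[i]) (x : G) : S x ->
  trig_poly S (fun g => c * echar x g).
Proof.
move=> Sx; exists 1%N, (fun=> c), (fun=> x); split=> //.
by apply/funext => g; rewrite big_ord1.
Qed.

Lemma trig_poly_cst (c : R[i]) : trig_poly setT (fun _ : dual R G => c).
Proof.
have -> : (fun _ : dual R G => c) = (fun g => c * echar 0 g).
  by apply/funext => g; rewrite echar0 mulr1.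
exact: trig_poly_monomial.
Qed.

Lemma trig_poly_ind S (C : (dual R G -> R[i]) -> Prop) :
  C (fun=> 0) ->
  (forall c x P, S x -> trig_poly S P -> C P ->
     C (fun g => c * echar x g + P g)) ->
  forall P, trig_poly S P -> C P.
Proof.
move=> C0 CS P [n [a [x [Sx ->]]]]; elim: n a x Sx => [|n IHn] a x Sx.
  by under eq_fun do rewrite big_ord0.
under eq_fun do rewrite big_ord_recl; apply: CS => //; last exact: IHn.
by exists n, (fun j => a (lift ord0 j)), (fun j => x (lift ord0 j)).
Qed.

Lemma trig_polyM P Q : trig_poly setT P -> trig_poly setT Q ->
  trig_poly setT (fun g => P g * Q g).
Proof.
move=> tP tQ; move: P tP; apply: trig_poly_ind => [|c x P _ _ tPQ].
  by under eq_fun do rewrite mul0r; exact: trig_poly0.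
under eq_fun do rewrite mulrDl; apply: trig_polyD => //.
move: tQ => [n [b [y [_ ->]]]].
exists n, (fun j => c * b j), (fun j => x + y j); split=> //.
apply/funext => g; rewrite mulr_sumr; apply: eq_bigr => j _.
by rewrite echarD mulrACA.
Qed.

Lemma trig_poly_conj P : trig_poly setT P -> trig_poly setT (fun g => conjc (P g)).
Proof.
move: P; apply: trig_poly_ind => [|c x P _ _ tP].
  by under eq_fun do rewrite conjc0; exact: trig_poly0.
have -> : (fun g : dual R G => conjc (c * echar x g + P g)) =
    (fun g => conjc c * echar (- x) g + conjc (P g)).
  by apply/funext => g; rewrite rmorphD rmorphM/= echarN.
by apply: trig_polyD => //; exact: trig_poly_monomial.
Qed.

Lemma trig_poly_bounded S P : trig_poly S P ->
  exists2 M : R, 0 < M & forall g, normc (P g) <= M.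
Proof.
move: P; apply: trig_poly_ind => [|c x P _ _ [M M0 PM]].
  by exists 1 => // g; rewrite normc0.
exists (normc c + M) => [|g]; first by rewrite ltr_wpDl// normc_ge0.
rewrite (le_trans (le_normcD _ _))// lerD//.
by rewrite normcM normc_echar mulr1.
Qed.

(** Singling out the constant term: a trigonometric polynomial whose constant
    term [c] is nonzero is [c] times a function [1 - tau'], with [tau']
    admissible in the infimum that defines [dp]. *)
Lemma trig_poly_split P : trig_poly setT P ->
  exists (c : R[i]) tau, trig_poly [set x : G | x <> 0] tau /\
    P = (fun g => c + tau g).
Proof.
move: P; apply: trig_poly_ind => [|a x P _ _ [c [tau [ttau ->]]]].
  exists 0, (fun=> 0); split; first exact: trig_poly0.
  by apply/funext => g; rewrite addr0.
have [->|x0] := eqVneq x 0.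
  by exists (a + c), tau; split=> //; apply/funext => g; rewrite echar0 mulr1 addrA.
exists c, (fun g => a * echar x g + tau g); split.
  by apply: trig_polyD => //; apply: trig_poly_monomial => /=; exact/eqP.
by apply/funext => g; rewrite addrCA.
Qed.

(** Real-valued trigonometric polynomials form a real algebra of functions on
    the dual that contains the real and imaginary parts of all characters; the
    whole approximation argument takes place inside it. *)
Definition real_trig (u : dual R G -> R) : Prop :=
  trig_poly setT (fun g => (u g)%:C%C).

Lemma real_trig_cst (c : R) : real_trig (fun=> c).
Proof. exact: trig_poly_cst. Qed.

Lemma real_trigD u v : real_trig u -> real_trig v ->
  real_trig (fun g => u g + v g).
Proof.
by move=> tu tv; rewrite /real_trig; under eq_fun do rewrite rmorphD/=;
  exact: trig_polyD.
Qed.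

Lemma real_trigM u v : real_trig u -> real_trig v ->
  real_trig (fun g => u g * v g).
Proof.
by move=> tu tv; rewrite /real_trig; under eq_fun do rewrite rmorphM/=;
  exact: trig_polyM.
Qed.

Lemma real_trigZ c u : real_trig u -> real_trig (fun g => c * u g).
Proof. by apply: real_trigM; exact: real_trig_cst. Qed.

Lemma real_trigB u v : real_trig u -> real_trig v ->
  real_trig (fun g => u g - v g).
Proof.
move=> tu tv; apply: real_trigD => //.
by under eq_fun do rewrite -mulN1r; exact: real_trigZ.
Qed.

Lemma real_trigX n u : real_trig u -> real_trig (fun g => u g ^+ n).
Proof.
move=> tu; elim: n => [|n IHn]; first exact: real_trig_cst.
by under eq_fun do rewrite exprS; exact: real_trigM.
Qed.

Lemma real_trig_Re P : trig_poly setT P -> real_trig (fun g => complex.Re (P g)).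
Proof.
move=> tP; rewrite /real_trig; under eq_fun do rewrite ReJ_add mulrC.
by apply/trig_polyZ/trig_polyD => //; exact: trig_poly_conj.
Qed.

Lemma real_trig_Im P : trig_poly setT P -> real_trig (fun g => complex.Im (P g)).
Proof.
move=> tP.
have -> : (fun g => complex.Im (P g)) = (fun g => complex.Re (- 'i%C * P g)).
  by apply/funext => g; rewrite mulNr raddfN/= mulrC ReiNIm opprK.
exact/real_trig_Re/trig_polyZ.
Qed.

Lemma real_trig_bounded u : real_trig u ->
  exists2 M : R, 0 < M & forall g, `|u g| <= M.
Proof.
move=> /trig_poly_bounded[M M0 uM]; exists M => // g; have := uM g.
by rewrite /normc/= expr0n/= addr0 sqrtr_sqr.
Qed.

End trig_algebra.

(** * Topology of the dual group *)

Section dual_topology.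
Variables (R : realType) (G : zmodType).
Implicit Types (S : set G) (P Q tau : dual R G -> R[i]) (u v : dual R G -> R).

Lemma Re_le_normc (z : R[i]) : `|complex.Re z| <= normc z.
Proof.
case: z => a b; rewrite -[leLHS]sqrtr_sqr ler_wsqrtr//=.
by rewrite lerDl sqr_ge0.
Qed.

Lemma Im_le_normc (z : R[i]) : `|complex.Im z| <= normc z.
Proof.
case: z => a b; rewrite -[leLHS]sqrtr_sqr ler_wsqrtr//=.
by rewrite lerDr sqr_ge0.
Qed.

Lemma echar_continuous (x : G) : continuous (echar x : dual R G -> R[i]).
Proof.
move=> g; apply: (@cvg_comp _ _ _ (@dual_fun R G) (fun f : G -> R[i] => f x)
  (nbhs g) (nbhs (dual_fun g : {ptws G -> R[i]}))).
  exact: (@initial_continuous (dual R G) {ptws G -> R[i]} (@dual_fun R G) g).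
exact: (@proj_continuous G (fun=> R[i]) x).
Qed.

Lemma Re_continuous : continuous (@complex.Re R : R[i] -> R).
Proof.
move=> z A /nbhs_ballP[e/= e0 eA].
exists e%:C%C => /=; first by rewrite ltcR.
move=> w /= zw; apply: eA; rewrite /ball/= -raddfB/= -ltcR (le_lt_trans _ zw)//.
by rewrite -[ `|z - w|]/((normc _)%:C%C) lecR Re_le_normc.
Qed.

Lemma Im_continuous : continuous (@complex.Im R : R[i] -> R).
Proof.
move=> z A /nbhs_ballP[e/= e0 eA].
exists e%:C%C => /=; first by rewrite ltcR.
move=> w /= zw; apply: eA; rewrite /ball/= -raddfB/= -ltcR (le_lt_trans _ zw)//.
by rewrite -[ `|z - w|]/((normc _)%:C%C) lecR Im_le_normc.
Qed.

Lemma trig_poly_continuous P : trig_poly setT P ->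
  continuous (fun g => complex.Re (P g)) /\ continuous (fun g => complex.Im (P g)).
Proof.
move: P; apply: trig_poly_ind => [|c x P _ _ [cR cI]].
  by split; exact: cst_continuous.
have eR : continuous (fun g => complex.Re (echar x g) : R).
  by move=> g; apply: continuous_comp; [exact: echar_continuous|exact: Re_continuous].
have eI : continuous (fun g => complex.Im (echar x g) : R).
  by move=> g; apply: continuous_comp; [exact: echar_continuous|exact: Im_continuous].
split.
  have -> : (fun g => complex.Re (c * echar x g + P g)) = (fun g =>
      complex.Re c * complex.Re (echar x g) - complex.Im c * complex.Im (echar x g) +
      complex.Re (P g)).
    by apply/funext => g /=; case: (c) (echar x g) (P g) => [? ?] [? ?] [].
  move=> g.
  exact: (cvgD (cvgB (cvgMl_tmp (eR g)) (cvgMl_tmp (eI g))) (cR g)).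
have -> : (fun g => complex.Im (c * echar x g + P g)) = (fun g =>
    complex.Re c * complex.Im (echar x g) + complex.Im c * complex.Re (echar x g) +
    complex.Im (P g)).
  by apply/funext => g /=; case: (c) (echar x g) (P g) => [? ?] [? ?] [? ?] /=;
    rewrite [_ * _ + _ * _]addrC.
move=> g.
exact: (cvgD (cvgD (cvgMl_tmp (eI g)) (cvgMl_tmp (eR g))) (cI g)).
Qed.

Lemma real_trig_continuous u : real_trig u -> continuous u.
Proof. by move=> /trig_poly_continuous[]. Qed.

Lemma open_real_trig_lt1 u : real_trig u -> open [set g | u g < 1].
Proof.
move=> /real_trig_continuous /continuousP cu.
rewrite (_ : [set g | _] = u @^-1` `]-oo, 1[%classic).
  exact/cu/interval_open.
by apply/seteqP; split => g /=; rewrite in_itv.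
Qed.

Lemma continuous_dual_measurable u : continuous u -> measurable_fun setT u.
Proof.
move=> /continuousP cu; apply: (measurability _ (RGenOpens.measurableE R)).
move=> _ [_ [a [b ->]] <-]; rewrite setTI; apply: sub_sigma_algebra.
exact/cu/interval_open.
Qed.

Lemma real_trig_measurable u : real_trig u -> measurable_fun setT u.
Proof. by move=> /real_trig_continuous/continuous_dual_measurable. Qed.

Lemma open_dual_measurable (U : set (dual R G)) : open U -> measurable U.
Proof. exact: sub_sigma_algebra. Qed.

Lemma dual_hausdorff : hausdorff_space (dual R G).
Proof.
move=> f g fg; apply: dual_ext => x.
have h : hausdorff_space R[i].
  exact: (@norm_hausdorff _ (R[i]^o)).
apply: h => A B fA gB.
have /fg/(_ (echar_continuous gB)) : nbhs f (echar x @^-1` A) := echar_continuous fA.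
by move=> [h [hA hB]]; exists (h x).
Qed.

Lemma compact_dual_measurable (K : set (dual R G)) : compact K -> measurable K.
Proof.
move=> cK; rewrite -(setCK K); apply: measurableC; apply: open_dual_measurable.
exact/closed_openC/(compact_closed dual_hausdorff).
Qed.

(** The sublevel sets [v < 1] of nonnegative [v] vanishing at [g] form a
    neighbourhood base: they are stable under intersection, because one may add
    two such functions, and the choice [|e_x - e_x g|^2 / e^2] shows that the
    filter they generate converges to [g] in every coordinate [x]. *)
Lemma nbhs_real_trig (g : dual R G) (U : set (dual R G)) : open U -> U g ->
  exists v, [/\ real_trig v, v g = 0, (forall h, 0 <= v h) & [set h | v h < 1] `<=` U].
Proof.
move=> oU Ug.
pose F : set_system (dual R G) := [set A | exists v, [/\ real_trig v, v g = 0,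
  (forall h, 0 <= v h) & [set h | v h < 1] `<=` A]].
have FF : Filter F.
  split.
  - by exists (fun=> 0); split=> //; exact: real_trig_cst.
  - move=> A B [v [tv vg v0 vA]] [w [tw wg w0 wB]].
    exists (fun h => v h + w h); split=> [|||h /= vw1].
    + exact: real_trigD.
    + by rewrite vg wg addr0.
    + by move=> h; rewrite addr_ge0.
    + split; [apply: vA|apply: wB]; rewrite /= (le_lt_trans _ vw1)//.
        by rewrite lerDl.
      by rewrite lerDr.
  - by move=> A B AB [v [tv vg v0 vA]]; exists v; split=> // h /vA/AB.
suff Fg : F --> g by apply: Fg; exact: open_nbhs_nbhs.
have cvF : {ptws, (@dual_fun R G @ F) --> dual_fun g}.
  apply/cvg_sup => x A [_ [[B oB <-] Bg] BA].
  have [e /= e0 eB] : nbhs (dual_fun g x) B by exact: open_nbhs_nbhs.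
  have e'0 : 0 < complex.Re e by move: e0; rewrite ltcE => /andP[].
  have eE : (complex.Re e)%:C%C = e by rewrite RRe_real// gtr0_real.
  pose z h := echar x h - echar x g.
  have tz : trig_poly setT z.
    apply: trig_polyD; last exact: trig_poly_cst.
    rewrite (_ : echar x = fun h : dual R G => 1 * echar x h).
      exact: trig_poly_monomial.
    by apply/funext => h; rewrite mul1r.
  exists (fun h => (complex.Re e) ^- 2 *
     (complex.Re (z h) ^+ 2 + complex.Im (z h) ^+ 2)).
  split=> [|||h /= zh1].
  - apply/real_trigZ/real_trigD; apply: real_trigX.
      exact: real_trig_Re.
    exact: real_trig_Im.
  - by rewrite /z subrr/= expr0n/= addr0 mulr0.
  - by move=> h; rewrite mulr_ge0// ?invr_ge0 ?addr_ge0 ?sqr_ge0.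
  - apply/BA/eB => /=; rewrite -eE distrC.
    rewrite -[ `|_|]/((normc _)%:C%C) ltcR -[echar x h - _]/(z h).
    move: zh1; rewrite mulrC ltr_pdivrMr ?exprn_gt0// mul1r.
    case: (z h) => a b /= ab; rewrite -(ltr_pXn2r (n := 2))// ?nnegrE ?sqrtr_ge0 ?(ltW e'0)//.
    by rewrite sqr_sqrtr// addr_ge0// sqr_ge0.
move=> A [_ [[B oB <-] Bg] BA].
have : nbhs (dual_fun g : {ptws G -> R[i]}) B by apply: open_nbhs_nbhs.
by move=> /cvF; exact: (@filterS _ F FF).
Qed.

End dual_topology.

(** * Approximating Borel sets by trigonometric polynomials *)

Section indicator_approximation.
Variables (R : realType) (G : zmodType).
Implicit Types (A K U W : set (dual R G)) (u v Q : dual R G -> R).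

(** A polynomial self-map of [-1, 1] with fixed points -1, 0 and 1, the outer
    two attracting and the inner one repelling: its iterates converge pointwise
    to the sign function, so that the half-line indicator becomes a bounded
    pointwise limit of polynomials. *)
Definition sgn_step (t : R) : R := (3 * t - t ^+ 3) / 2.

Lemma sgn_step_bound (t : R) : -1 <= t <= 1 -> -1 <= sgn_step t <= 1.
Proof.
move=> /andP[t1 t2]; rewrite /sgn_step.
have h1 : 0 <= (1 - t) ^+ 2 * (2 + t) by rewrite mulr_ge0 ?sqr_ge0//; lra.
have h2 : 0 <= (1 + t) ^+ 2 * (2 - t) by rewrite mulr_ge0 ?sqr_ge0//; lra.
apply/andP; split; nra.
Qed.

Lemma sgn_iter_bound n (t : R) : -1 <= t <= 1 -> -1 <= iter n sgn_step t <= 1.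
Proof. by move=> t1; elim: n => //= n IHn; exact: sgn_step_bound. Qed.

Lemma sgn_iterN n (t : R) : iter n sgn_step (- t) = - iter n sgn_step t.
Proof. by elim: n => //= n ->; rewrite /sgn_step; field. Qed.

(** The quantitative form of the convergence comes from
    [1 - sgn_step x = (1 - x) ((1 - x) (2 + x) / 2)], whose second factor is at
    most [1 - t / 2] as soon as [x >= t]; and the iterates never drop below [t]. *)
Lemma sgn_iter_pos n (t : R) : 0 < t -> t <= 1 ->
  t <= iter n sgn_step t <= 1 /\ 1 - iter n sgn_step t <= (1 - t / 2) ^+ n.
Proof.
move=> t0 t1; elim: n => [|n [/andP[tx x1] IHn]] /=.
  by rewrite lexx t1 expr0; split=> //; lra.
set x := iter n sgn_step t in tx x1 IHn *.
have x0 : 0 < x by exact: lt_le_trans tx.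
have E : 1 - sgn_step x = (1 - x) * ((1 - x) * (2 + x) / 2).
  by rewrite /sgn_step; field.
have h1 : (1 - x) * (2 + x) / 2 <= 1 - t / 2 by nra.
have h2 : 0 <= (1 - x) * (2 + x) / 2.
  by rewrite divr_ge0// mulr_ge0//; lra.
split.
  have : 0 <= 1 - sgn_step x by rewrite E mulr_ge0//; lra.
  have : 0 <= x * ((1 - x) * (1 + x)) / 2.
    by rewrite divr_ge0// mulr_ge0 ?(ltW x0)// mulr_ge0//; lra.
  rewrite /sgn_step => ? ?; apply/andP; split; nra.
rewrite E exprSr; apply: ler_pM => //; lra.
Qed.

Lemma sgn_iter_cvg (t : R) : 0 < t -> t <= 1 ->
  iter n sgn_step t @[n --> \oo] --> (1 : R).
Proof.
move=> t0 t1.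
apply: (@squeeze_cvgr _ _ _ _ (fun n => 1 - (1 - t / 2) ^+ n) (cst 1)).
- apply: nearW => n; have [/andP[_ ->] h] := sgn_iter_pos n t0 t1.
  by rewrite andbT; lra.
- rewrite -[X in _ --> X]subr0; apply: cvgB; first exact: cvg_cst.
  by apply: cvg_expr; rewrite ger0_norm; lra.
- exact: cvg_cst.
Qed.

(** Keeping the approximants between 0 and 1 serves twice: it supplies the
    dominating function for dominated convergence, and it gives [Q^p <= Q] when
    an approximant [Q] is later inserted in a p-th power. *)
Definition trig_limit W : Prop := exists u : nat -> dual R G -> R,
  [/\ forall n, real_trig (u n), forall n g, 0 <= u n g <= 1 &
      forall g, u n g @[n --> \oo] --> (\1_W g : R)].

Lemma trig_limit0 : trig_limit set0.
Proof.
exists (fun _ => fun=> 0); split=> [n|n g|g]; first exact: real_trig_cst.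
  by rewrite lexx ler01.
by rewrite indic0; exact: cvg_cst.
Qed.

Lemma trig_limitU W W' : trig_limit W -> trig_limit W' -> trig_limit (W `|` W').
Proof.
move=> [u [tu u01 uW]] [v [tv v01 vW]].
exists (fun n g => 1 - (1 - u n g) * (1 - v n g)); split=> [n|n g|g].
- by apply: real_trigB; [|apply: real_trigM; apply: real_trigB] => //;
    exact: real_trig_cst.
- by have /andP[? ?] := u01 n g; have /andP[? ?] := v01 n g;
    apply/andP; split; nra.
- have -> : \1_(W `|` W') g = 1 - (1 - \1_W g) * (1 - \1_W' g) :> R.
    rewrite !indicE in_setU; case: (g \in W); case: (g \in W') => /=; ring.
  apply: (cvgB (cvg_cst _)).
  by apply: cvgM; apply: (cvgB (cvg_cst _)); [exact: uW|exact: vW].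
Qed.

Lemma real_trig_iter n u : real_trig u ->
  real_trig (fun g => iter n sgn_step (u g)).
Proof.
move=> tu; elim: n => [|n IHn] //=.
have -> : (fun g => sgn_step (iter n sgn_step (u g))) =
  (fun g => 2^-1 * (3 * iter n sgn_step (u g) - iter n sgn_step (u g) ^+ 3)).
  by apply/funext => g; rewrite /sgn_step mulrC.
apply/real_trigZ/real_trigB; [exact: real_trigZ|exact: real_trigX].
Qed.

Lemma trig_limit_lt1 v : real_trig v -> trig_limit [set g | v g < 1].
Proof.
move=> tv; have tw : real_trig (fun g => 1 - v g).
  by apply: real_trigB => //; exact: real_trig_cst.
have [M M0 wM] := real_trig_bounded tw.
pose t g := M^-1 * (1 - v g).
have tt : real_trig t by exact: real_trigZ.
have t1 g : -1 <= t g <= 1.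
  by rewrite -ler_norml normrM gtr0_norm ?invr_gt0// mulrC ler_pdivrMr// mul1r.
pose s n g := iter n sgn_step (t g).
have ts n : real_trig (s n) by exact: real_trig_iter.
(* s^2 (1 + s) / 2 sends the three limits 1, 0, -1 of s to 1, 0, 0. *)
exists (fun n g => 2^-1 * (s n g ^+ 2 * (1 + s n g))); split=> [n|n g|g].
- apply/real_trigZ/real_trigM; first exact: real_trigX.
  by apply: real_trigD => //; exact: real_trig_cst.
- have /andP[s1 s2] : -1 <= s n g <= 1 by exact: sgn_iter_bound.
  have h : s n g ^+ 2 <= 1 by nra.
  have h' := sqr_ge0 (s n g).
  apply/andP; split; nra.
- suff [l [sl lE]] : exists l : R, s n g @[n --> \oo] --> l /\
      \1_[set g | v g < 1] g = 2^-1 * (l ^+ 2 * (1 + l)) :> R.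
    rewrite lE; apply: (cvgM (cvg_cst _)); apply: cvgM.
      by rewrite expr2; under eq_fun do rewrite expr2; exact: cvgM.
    exact: cvgD (cvg_cst _) sl.
  have [vg|vg|vg] := ltgtP (v g) 1.
  + exists 1; split; last by rewrite indicE mem_set//=; field.
    apply: sgn_iter_cvg; last by have /andP[] := t1 g.
    by rewrite mulr_gt0 ?invr_gt0// subr_gt0.
  + exists (-1); split; last first.
      by rewrite indicE memNset/= ?subrr ?mulr0// => /ltW; rewrite leNgt vg.
    have -> : (fun n => s n g) = (fun n => - iter n sgn_step (- t g)).
      by apply/funext => n; rewrite -sgn_iterN opprK.
    apply: cvgN; apply: sgn_iter_cvg.
      by rewrite -mulrN mulr_gt0 ?invr_gt0// opprB subr_gt0.
    by have /andP[] := t1 g; lra.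
  + exists 0; split; last first.
      by rewrite indicE memNset/= ?vg ?ltxx// expr0n/= mul0r mulr0.
    have -> : (fun n => s n g) = (fun=> 0).
      apply/funext => n; rewrite /s /t vg subrr mulr0.
      by elim: n => //= n ->; rewrite /sgn_step expr0n/= mulr0 subr0 mul0r.
    exact: cvg_cst.
Qed.

(** This takes the place of Urysohn's lemma: by compactness, finitely many basic
    neighbourhoods [v < 1] contained in [U] cover [K], and the indicator of
    their union is a bounded limit of trigonometric polynomials. *)
Lemma compact_trig_limit K U : compact K -> open U -> K `<=` U ->
  exists W, [/\ trig_limit W, measurable W, K `<=` W & W `<=` U].
Proof.
move=> cK oU KU.
have /choice[v vP] : forall g : dual R G, exists v, U g ->
    [/\ real_trig v, v g = 0, (forall h, 0 <= v h) & [set h | v h < 1] `<=` U].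
  move=> g; have [Ug|] := pselect (U g); last by exists (fun=> 0).
  by have [v vP] := nbhs_real_trig oU Ug; exists v.
pose f g := [set h | v g h < 1].
have of_ g : U g -> open (f g).
  by move=> /vP[tv _ _ _]; exact: open_real_trig_lt1.
move: cK; rewrite compact_cover => /(_ _ U f of_)[].
  by move=> g /KU Ug; exists g => //; rewrite /f/=; have [_ -> _ _] := vP _ Ug.
move=> D DU KD; exists (cover [set` D] f); split=> //.
- rewrite /cover bigcup_fset big_seq; apply: big_ind => //.
  + exact: trig_limit0.
  + exact: trig_limitU.
  + move=> g /DU; rewrite inE => /vP[tv _ _ _]; exact: trig_limit_lt1.
- by apply: open_dual_measurable; apply: bigcup_open => g /= /DU; rewrite inE; exact: of_.
- by move=> h [g /= /DU]; rewrite inE => /vP[_ _ _]; apply.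
Qed.

Lemma regular_compact_open (mu : {finite_measure set (dual R G) -> \bar R}) A
    (e : R) : regular_measure mu -> measurable A -> 0 < e ->
  exists K U, [/\ compact K, open U, K `<=` A, A `<=` U & (mu (U `\` K) < e%:E)%E].
Proof.
move=> rmu mA e0; have [muAi muAs] := rmu _ mA.
have e20 : 0 < e / 2 by rewrite divr_gt0.
have fA : mu A \is a fin_num by exact: fin_num_measure.
have [_ [U [oU AU] <-] UA] : exists2 x, [set mu U | U in [set U | open U /\ A `<=` U]] x &
    (x < mu A + (e / 2)%:E)%E.
  by rewrite muAi in fA *; exact: lb_ereal_inf_adherent.
have [_ [K [cK KA] <-] KA'] : exists2 x, [set mu K | K in [set K | compact K /\ K `<=` A]] x &
    (mu A - (e / 2)%:E < x)%E.
  by rewrite muAs in fA *; exact: ub_ereal_sup_adherent.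
exists K, U; split=> //.
have mU : measurable U by exact: open_dual_measurable.
have mK : measurable K by exact: compact_dual_measurable.
have fU : mu U \is a fin_num by exact: fin_num_measure.
have fK : mu K \is a fin_num by exact: fin_num_measure.
have key : (mu U - mu K < e%:E)%E.
  move: UA KA'; rewrite -(fineK fA) -(fineK fU) -(fineK fK) -!EFinB -EFinD !lte_fin.
  lra.
rewrite measureD//; last by rewrite -ge0_fin_numE// fin_num_measure.
rewrite setIidr; last exact: subset_trans AU.
exact: key.
Qed.

Lemma trig_limit_integral_cvg (mu : {finite_measure set (dual R G) -> \bar R})
    W (u : nat -> dual R G -> R) : measurable W ->
  (forall n, real_trig (u n)) -> (forall n g, 0 <= u n g <= 1) ->
  (forall g, u n g @[n --> \oo] --> (\1_W g : R)) ->
  (\int[mu]_g `|\1_W g - u n g|%:E)%E @[n --> \oo] --> 0%E.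
Proof.
move=> mW tu u01 uW.
have mu_ n : measurable_fun setT (u n) by exact: real_trig_measurable.
have [] := @dominated_convergence _ _ R mu setT measurableT
  (fun n g => (u n g)%:E) (fun g => (\1_W g)%:E) (cst 1%E).
- by move=> n; exact/measurable_EFinP.
- exact/measurable_EFinP/measurable_indic.
- by apply: aeW => g _; apply: cvg_EFin; [exact: nearW|exact: uW].
- exact: finite_measure_integrable_cst.
- by apply: aeW => g n _ /=; have /andP[u0 u1] := u01 n g; rewrite lee_fin ger0_norm.
move=> _ + _; apply: cvg_trans; apply: near_eq_cvg; apply: nearW => n.
by apply: eq_integral => g _; rewrite distrC.
Qed.

(** Density of the trigonometric polynomials in [L^1], for two regular measures at
    once and with the bounds [0 <= Q <= 1]. Squeeze [A] between a compact [K] and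
    an open [U] with [U `\` K] small for both measures, and pick [W] between
    them as above: the indicators of [A] and [W] differ only on [U `\` K]. *)
Lemma indic_real_trig (mu lambda : {finite_measure set (dual R G) -> \bar R})
    A (e : R) :
  regular_measure mu -> regular_measure lambda -> measurable A -> 0 < e ->
  exists Q, [/\ real_trig Q, forall g, 0 <= Q g <= 1,
    (\int[mu]_g `|\1_A g - Q g|%:E < e%:E)%E &
    (\int[lambda]_g `|\1_A g - Q g|%:E < e%:E)%E].
Proof.
move=> rmu rla mA e0; have e20 : 0 < e / 2 by rewrite divr_gt0.
have [K1 [U1 [cK1 oU1 K1A AU1 mu1]]] := regular_compact_open rmu mA e20.
have [K2 [U2 [cK2 oU2 K2A AU2 la2]]] := regular_compact_open rla mA e20.
have [|||W [[u [tu u01 uW]] mW KW WU]] :=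
  @compact_trig_limit (K1 `|` K2) (U1 `&` U2).
- exact: compactU.
- exact: openI.
- by move=> g [/K1A|/K2A] Ag; split; [exact: AU1|exact: AU2|exact: AU1|exact: AU2].
have key (m : {finite_measure set (dual R G) -> \bar R}) K U :
    measurable K -> measurable U -> K `<=` A -> A `<=` U -> K `<=` W -> W `<=` U ->
    (m (U `\` K) < (e / 2)%:E)%E ->
    \forall n \near \oo, (\int[m]_g `|\1_A g - u n g|%:E < e%:E)%E.
  move=> mK' mU KA AU KW' WU' UK.
  have cv := trig_limit_integral_cvg m mW tu u01 uW.
  have : \forall n \near \oo, (\int[m]_g `|\1_W g - u n g|%:E < (e / 2)%:E)%E.
    have /fine_cvgP[fn cv'] := cv.
    move/cvgrPdist_lt : cv' => /(_ _ e20); move: fn; apply: filterS2 => n fn /=.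
    by rewrite sub0r normrN => h; rewrite -(fineK fn) lte_fin (le_lt_trans _ h)// ler_norm.
  apply: filterS => n h.
  have mn : measurable_fun setT (u n) by exact: real_trig_measurable.
  have mUK : measurable (U `\` K) by exact: measurableD.
  have -> : (e%:E = (e / 2)%:E + (e / 2)%:E)%E by rewrite -EFinD; congr (_%:E); field.
  apply: le_lt_trans (lteD UK h).
  rewrite -(setIT (U `\` K)) -(integral_indic m measurableT)//.
  have mf (B : set (dual R G)) : measurable B ->
      measurable_fun setT (fun g => `|\1_B g - u n g|%:E).
    move=> mB; apply/measurable_EFinP; apply: measurableT_comp => //.
    by apply: measurable_funB => //; exact: measurable_indic.
  have mi : measurable_fun setT (fun g => (\1_(U `\` K) g : R)%:E).
    exact/measurable_EFinP/measurable_indic.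
  rewrite -ge0_integralD//; last exact: mf.
  apply: ge0_le_integral => //.
  - exact: mf.
  - by apply: emeasurable_funD; [exact: mi|exact: mf].
  move=> g _; rewrite -EFinD lee_fin.
  have -> : \1_A g - u n g = (\1_A g - \1_W g) + (\1_W g - u n g) by ring.
  rewrite (le_trans (ler_normD _ _))// lerD2r.
  rewrite !indicE; case: (boolP (g \in U `\` K)) => [_|].
    by case: (g \in A); case: (g \in W);
       rewrite /= ?subrr ?subr0 ?sub0r ?normrN ?normr1 ?normr0.
  rewrite notin_setE => /not_andP[Ug|/contrapT Kg].
    by rewrite !memNset ?subrr ?normr0//; [move/WU'|move/AU].
  by rewrite !mem_set ?subrr ?normr0//; [exact: KW'|exact: KA].
have n1 := key mu K1 U1 (compact_dual_measurable cK1) (open_dual_measurable oU1) K1A AU1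
  (subset_trans (@subsetUl _ _ _) KW) (subset_trans WU (@subIsetl _ _ _)) mu1.
have n2 := key lambda K2 U2 (compact_dual_measurable cK2) (open_dual_measurable oU2) K2A AU2
  (subset_trans (@subsetUr _ _ _) KW) (subset_trans WU (@subIsetr _ _ _)) la2.
have [n [nmu nla]] := filter_ex (filterI n1 n2).
by exists (u n); split.
Qed.

End indicator_approximation.

(** * Orthogonality of characters *)

Section orthogonality.
Variables (R : realType) (G : zmodType).
Implicit Types (A U : set (dual R G)) (u : dual R G -> R) (tau P : dual R G -> R[i]).

Lemma bounded_integrable d (T : measurableType d)
    (mu : {finite_measure set T -> \bar R}) (f : T -> R) (M : R) :
  measurable_fun setT f -> (forall x, `|f x| <= M) ->
  mu.-integrable setT (EFin \o f).
Proof.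
move=> mf fM; apply: (@le_integrable _ _ _ _ _ measurableT _ (EFin \o cst M)).
- exact/measurable_EFinP.
- by move=> g _ /=; rewrite lee_fin (le_trans (fM g))// ler_norm.
- exact: finite_measure_integrable_cst.
Qed.

Lemma real_trig_integrable (mu : {finite_measure set (dual R G) -> \bar R}) u :
  real_trig u -> mu.-integrable setT (EFin \o u).
Proof.
move=> tu; have [M _ uM] := real_trig_bounded tu.
exact: bounded_integrable (real_trig_measurable tu) uM.
Qed.

Lemma echar_mulg (x : G) (g h : dual R G) :
  echar x (g * h)%g = echar x g * echar x h.
Proof. by []. Qed.

Lemma trig_poly_translate (g : dual R G) P : trig_poly setT P ->
  trig_poly setT (fun h => P (g * h)%g).
Proof.
move: P; apply: trig_poly_ind => [|c x P _ _ tP]; first exact: trig_poly0.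
apply: trig_polyD => //.
under eq_fun do rewrite echar_mulg mulrA.
exact: trig_poly_monomial.
Qed.

Lemma real_trig_open U : (forall g, U g ->
    exists v, [/\ real_trig v, v g < 1 & [set h | v h < 1] `<=` U]) -> open U.
Proof.
move=> Uv; rewrite openE => g /Uv[v [tv vg vU]].
apply: (filterS vU); apply: open_nbhs_nbhs; split=> //.
exact: open_real_trig_lt1.
Qed.

(** Pulling basic neighbourhoods back along a translation again gives basic
    neighbourhoods, since translates of trigonometric polynomials are
    trigonometric polynomials. *)
Lemma translate_measurable (g : dual R G) :
  measurable_fun setT (fun h : dual R G => (g * h)%g).
Proof.
apply: (@measurability _ _ _ _ _ _ (@open (dual R G))) => //.
move=> _ [U oU <-]; rewrite setTI; apply: open_dual_measurable.
apply: real_trig_open => h /= Ugh; have [v [tv v0 _ vU]] := nbhs_real_trig oU Ugh.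
exists (fun k => v (g * k)%g); split; last by move=> k /vU.
  exact: (trig_poly_translate g tv).
by rewrite v0.
Qed.

Variable lambda : {finite_measure set (dual R G) -> \bar R}.
Hypothesis hlambda : normalized_haar lambda.

Lemma haar_translate (g : dual R G) u : real_trig u ->
  (\int[lambda]_h u (g * h)%g = \int[lambda]_h u h)%R.
Proof.
move=> tu; have [_ _ inv] := hlambda; have mt := translate_measurable g.
congr fine.
rewrite -[LHS](@integral_pushforward _ _ _ _ R _ mt lambda setT (EFin \o u))//.
- apply: eq_measure_integral => A mA _.
  apply: etrans (inv g^-1%g _ mA); congr (lambda _).
  apply/seteqP; split=> [h /= Agh|_ [h Ah <-] /=].
    by exists (g * h)%g => //; rewrite mulgA mulVg mul1g.
  by rewrite mulgA mulgV mul1g.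
- by apply/measurable_EFinP; exact: real_trig_measurable.
- exact: real_trig_integrable (trig_poly_translate g tu : real_trig _).
Qed.

Lemma real_trig_echar (x : G) :
  real_trig (fun g : dual R G => complex.Re (echar x g)) /\
  real_trig (fun g : dual R G => complex.Im (echar x g)).
Proof.
have te : trig_poly setT (echar x : dual R G -> R[i]).
  rewrite (_ : echar x = fun h : dual R G => 1 * echar x h).
    exact: trig_poly_monomial.
  by apply/funext => h; rewrite mul1r.
by split; [exact: real_trig_Re|exact: real_trig_Im].
Qed.

(** Invariance gives [m = e_x(g) m] for the complex mean [m] of [e_x]. It is
    spelled out on the real and imaginary parts [I], [J] of [m]; the
    determinant of the resulting linear system is [|1 - e_x(g)|^2]. *)
Lemma echar_mean0 (x : G) (g : dual R G) : echar x g <> 1 ->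
  (\int[lambda]_h complex.Re (echar x h) = 0)%R /\
  (\int[lambda]_h complex.Im (echar x h) = 0)%R.
Proof.
move=> xg1; have [tR tI] := real_trig_echar x.
have iR := real_trig_integrable lambda tR; have iI := real_trig_integrable lambda tI.
have iZ c u : lambda.-integrable setT (EFin \o u) ->
    lambda.-integrable setT (EFin \o (fun h => c * u h)).
  by move=> iu; have := integrableZl measurableT c iu; congr (integrable _ _ _).
set I := Rintegral _ _ _; set J := Rintegral _ _ _.
pose a := complex.Re (echar x g); pose b := complex.Im (echar x g).
have EI : I = a * I - b * J.
  rewrite {1}/I -(haar_translate g tR) -!RintegralZl// -RintegralB//; try exact: iZ.
  by apply: eq_Rintegral => h _; rewrite echar_mulg /a /b;
    case: (echar x g) (echar x h) => [? ?] [].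
have EJ : J = b * I + a * J.
  rewrite {1}/J -(haar_translate g tI) -!RintegralZl// -RintegralD//; try exact: iZ.
  by apply: eq_Rintegral => h _; rewrite echar_mulg /a /b;
    case: (echar x g) (echar x h) => [? ?] [? ?] /=; rewrite addrC.
have D0 : 0 < (1 - a) ^+ 2 + b ^+ 2.
  rewrite lt_neqAle addr_ge0 ?sqr_ge0// andbT eq_sym paddr_eq0 ?sqr_ge0//.
  apply/negP; rewrite !sqrf_eq0 subr_eq0 => /andP[/eqP a1 /eqP b0].
  by apply: xg1; move: a1 b0; rewrite /a /b; case: (echar x g) => ? ? /= <- ->.
have h1 : ((1 - a) ^+ 2 + b ^+ 2) * I = 0.
  have -> : ((1 - a) ^+ 2 + b ^+ 2) * I =
    (1 - a) * (I - (a * I - b * J)) - b * (J - (b * I + a * J)) by ring.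
  by rewrite -EI -EJ !subrr !mulr0 subrr.
have h2 : ((1 - a) ^+ 2 + b ^+ 2) * J = 0.
  have -> : ((1 - a) ^+ 2 + b ^+ 2) * J =
    (1 - a) * (J - (b * I + a * J)) + b * (I - (a * I - b * J)) by ring.
  by rewrite -EI -EJ !subrr !mulr0 addr0.
by split; apply/eqP; [move/eqP : h1|move/eqP : h2]; rewrite mulf_eq0 gt_eqF.
Qed.

Hypothesis separated :
  forall x : G, x <> 0 -> exists g : dual R G, echar x g <> 1.

Lemma trig_poly_mean0 tau : trig_poly [set x : G | x <> 0] tau ->
  (\int[lambda]_h complex.Re (tau h) = 0)%R.
Proof.
move: tau; apply: trig_poly_ind => [|c x P x0 tP IHP].
  by rewrite Rintegral_cst// mul0r.
have [g xg1] := separated x0.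
have [mR mI] := echar_mean0 xg1; have [tR tI] := real_trig_echar x.
have iR := real_trig_integrable lambda tR; have iI := real_trig_integrable lambda tI.
have iP : lambda.-integrable setT (EFin \o (fun h => complex.Re (P h))).
  by apply/real_trig_integrable/real_trig_Re/(trig_poly_sub _ tP).
have iZ k u : lambda.-integrable setT (EFin \o u) ->
    lambda.-integrable setT (EFin \o (fun h => k * u h)).
  by move=> iu; have := integrableZl measurableT k iu; congr (integrable _ _ _).
transitivity (\int[lambda]_h ((complex.Re c * complex.Re (echar x h) -
   complex.Im c * complex.Im (echar x h)) + complex.Re (P h)))%R.
  by apply: eq_Rintegral => h _; case: (c) (echar x h) (P h) => [? ?] [? ?] [].
rewrite RintegralD//; last first.
  by apply: real_trig_integrable; apply: real_trigB; exact: real_trigZ.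
rewrite RintegralB//; try exact: iZ.
by rewrite !RintegralZl// mR mI IHP !mulr0 subr0 addr0.
Qed.

End orthogonality.

(** * Bounding d_p by a truncated integral *)

Section upper_bound.
Variables (R : realType) (G : zmodType).
Implicit Types (A : set (dual R G)) (tau : dual R G -> R[i]) (Q : dual R G -> R).

Lemma normc_trig_measurable (P : dual R G -> R[i]) : trig_poly setT P ->
  measurable_fun setT (fun g => normc (P g)).
Proof.
move=> tP.
have -> : (fun g => normc (P g)) =
    (fun g => Num.sqrt (complex.Re (P g) ^+ 2 + complex.Im (P g) ^+ 2)).
  by apply/funext => g; case: (P g).
apply: (measurableT_comp (continuous_measurable_fun (@sqrt_continuous R))).
apply: real_trig_measurable; apply: real_trigD; apply: real_trigX.
  exact: real_trig_Re.
exact: real_trig_Im.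
Qed.

Lemma powR_le_id (p t : R) : 1 <= p -> 0 <= t <= 1 -> t `^ p <= t.
Proof.
move=> p1 /andP[t0 t1]; move: t0; rewrite le_eqVlt => /predU1P[<-|t0].
  by rewrite powR0// gt_eqF// (lt_le_trans _ p1).
by rewrite -[leRHS]powRr1 ?(ltW t0)// ger_powR// t0.
Qed.

Variable lambda : {finite_measure set (dual R G) -> \bar R}.
Hypothesis hlambda : normalized_haar lambda.
Hypothesis separated :
  forall x : G, x <> 0 -> exists g : dual R G, echar x g <> 1.

(** The constant term of [(1 - tau) Q] is its mean; as [1 - tau] has mean 1, it
    differs from 1 by at most the mean of [|1 - tau| (1 - Q)], and [1 - Q] is
    bounded by the indicator of the complement of [A] plus [|1_A - Q|]. *)
Lemma constant_term_lb tau A Q (a : R[i]) sigma (M l e : R) :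
  trig_poly [set x : G | x <> 0] tau -> (forall g, normc (1 - tau g) <= M) ->
  measurable A -> real_trig Q -> (forall g, 0 <= Q g <= 1) ->
  (lambda (~` A) <= l%:E)%E -> (\int[lambda]_g `|\1_A g - Q g|%:E <= e%:E)%E ->
  trig_poly [set x : G | x <> 0] sigma ->
  (fun g => (1 - tau g) * (Q g)%:C%C) = (fun g => a + sigma g) ->
  1 - M * (l + e) <= complex.Re a.
Proof.
move=> ttau tM mA tQ Q01 lA eA tsigma Ea.
have M0 : 0 <= M := le_trans (normc_ge0 _) (tM (dual_one R G)).
have ttau' : trig_poly setT tau by exact: trig_poly_sub ttau.
have tsigma' : trig_poly setT sigma by exact: trig_poly_sub tsigma.
have l1 : fine (lambda setT) = 1 by have [_ -> _] := hlambda.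
have iRt : lambda.-integrable setT (EFin \o (fun g => complex.Re (tau g))).
  exact/real_trig_integrable/real_trig_Re.
have iRs : lambda.-integrable setT (EFin \o (fun g => complex.Re (sigma g))).
  exact/real_trig_integrable/real_trig_Re.
have iQ : lambda.-integrable setT (EFin \o Q) by exact: real_trig_integrable.
have ic (c : R) : lambda.-integrable setT (EFin \o (fun _ : dual R G => c)).
  exact: finite_measure_integrable_cst.
have t1 : real_trig (fun g => 1 - complex.Re (tau g)).
  by apply: real_trigB; [exact: real_trig_cst|exact: real_trig_Re].
have t1Q : real_trig (fun g => 1 - Q g).
  by apply: real_trigB => //; exact: real_trig_cst.
have E1 : (\int[lambda]_g (1 - complex.Re (tau g)) = 1)%R.
  rewrite RintegralB//.
  by rewrite (trig_poly_mean0 hlambda separated ttau) Rintegral_cst// l1 mulr1 subr0.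
have E2 : (\int[lambda]_g (complex.Re a + complex.Re (sigma g)) = complex.Re a)%R.
  rewrite RintegralD//.
  by rewrite (trig_poly_mean0 hlambda separated tsigma) Rintegral_cst// l1 mulr1 addr0.
have E3 : complex.Re a =
    (1 - \int[lambda]_g ((1 - Q g) * (1 - complex.Re (tau g))))%R.
  rewrite -[X in X - _]E1 -RintegralB//; last 2 first.
    exact: real_trig_integrable.
    by apply: real_trig_integrable; apply: real_trigM.
  apply: etrans (esym E2) _; apply: eq_Rintegral => g _.
  move/(congr1 (fun f => complex.Re (f g))) : Ea.
  case: (a) (sigma g) (tau g) => [? ?] [? ?] [? ?] /= <-.
  by rewrite mulr0 subr0; ring.
have iA : lambda.-integrable setT (EFin \o (\1_(~` A) : dual R G -> R)).
  apply: (@bounded_integrable _ _ _ _ _ 1) => [|g].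
    exact: measurable_indic (measurableC mA).
  by rewrite indicE; case: (_ \in _); rewrite ?normr1 ?normr0.
have iAQ : lambda.-integrable setT (EFin \o (fun g => `|\1_A g - Q g|)).
  apply: (@bounded_integrable _ _ _ _ _ 1) => [|g].
    apply: measurableT_comp => //; apply: measurable_funB; first exact: measurable_indic.
    exact: real_trig_measurable.
  have /andP[? ?] := Q01 g.
  by rewrite normr_id ler_norml indicE; case: (_ \in _) => /=; apply/andP; split; lra.
have iAAQ : lambda.-integrable setT (EFin \o (fun g => \1_(~` A) g + `|\1_A g - Q g|)).
  by have := integrableD measurableT iA iAQ; congr (integrable _ _ _).
have iMA : lambda.-integrable setT (EFin \o (fun g => M * (\1_(~` A) g + `|\1_A g - Q g|))).
  by have := integrableZl measurableT M iAAQ; congr (integrable _ _ _).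
rewrite E3 lerD2l lerN2.
apply: le_trans (_ : (\int[lambda]_g (M * (\1_(~` A) g + `|\1_A g - Q g|)))%R <= _).
  apply: le_Rintegral => //; first by apply: real_trig_integrable; apply: real_trigM.
  move=> g _; have /andP[? ?] := Q01 g.
  have h1 : 1 - complex.Re (tau g) <= M.
    apply: le_trans (tM g); rewrite -[X in _ <= X]/(normc (1 - tau g)).
    have := Re_le_normc (1 - tau g); rewrite raddfB/= => h; exact: le_trans (ler_norm _) h.
  apply: le_trans (_ : (1 - Q g) * M <= _); first by rewrite ler_wpM2l// subr_ge0.
  rewrite mulrC ler_wpM2l//.
  rewrite -setTD setTD !indicE in_setC; case: (_ \in _) => /=.
    by rewrite add0r ler_norm.
  by rewrite sub0r normrN ger0_norm//; lra.
rewrite RintegralZl// ler_wpM2l// RintegralD// lerD//.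
  rewrite -lee_fin /Rintegral fineK.
    by rewrite integral_indic ?setIT//; exact: measurableC.
  by apply: integrable_fin_num => //; exact: iA.
rewrite -lee_fin /Rintegral fineK//.
by apply: integrable_fin_num => //; exact: iAQ.
Qed.

(** Cutting [1 - tau] off outside a set [A] of nearly full Haar measure keeps
    the real part of its mean above [c], so that dividing by the mean gives an
    admissible competitor, up to replacing the indicator of [A] by a trigonometric
    polynomial [Q]. What matters is that [mu] enters only through its restriction
    to [A]: mass that [mu] has outside [A] is harmless, however large. *)
Lemma dp_le_truncation (mu : {finite_measure set (dual R G) -> \bar R})
    tau A (p M c l b : R) :
  1 <= p -> regular_measure mu ->
  trig_poly [set x : G | x <> 0] tau -> (forall g, normc (1 - tau g) <= M) ->
  measurable A -> 0 < c -> (lambda (~` A) <= l%:E)%E -> c + M * l < 1 ->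
  (\int[mu]_(g in A) ((normc (1 - tau g)) `^ p)%:E < b%:E)%E ->
  (dp p mu [set x : G | x <> 0%R] <= (b / c `^ p)%:E)%E.
Proof.
move=> p1 rmu ttau tM mA c0 lA cM Ib.
have p0 : 0 < p by exact: lt_le_trans p1.
have M0 : 0 <= M := le_trans (normc_ge0 _) (tM (dual_one R G)).
have ttau' : trig_poly setT tau by exact: trig_poly_sub ttau.
have t1 : trig_poly setT (fun g => 1 - tau g).
  apply: trig_polyD; first exact: trig_poly_cst.
  by under eq_fun do rewrite -mulN1r; exact: trig_polyZ.
pose F g := normc (1 - tau g) `^ p.
have mF : measurable_fun setT F.
  by apply: (measurableT_comp (measurable_powR p)); exact: normc_trig_measurable.
have F0 g : 0 <= F g by exact: powR_ge0.
have FM g : F g <= M `^ p by apply: ge0_ler_powR; rewrite ?nnegrE ?normc_ge0// ltW.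
have I0 : (0 <= \int[mu]_(g in A) (F g)%:E)%E.
  by apply: integral_ge0 => g _; rewrite lee_fin.
have Ifin : (\int[mu]_(g in A) (F g)%:E)%E \is a fin_num.
  by rewrite ge0_fin_numE// (lt_trans Ib)// ltry.
set I := fine (\int[mu]_(g in A) (F g)%:E)%E.
have IE : (\int[mu]_(g in A) (F g)%:E)%E = I%:E by rewrite fineK.
have {}Ib : I < b by rewrite -lte_fin -IE.
have Mp0 : 0 <= M `^ p by exact: powR_ge0.
have [e [e0 eM eMp]] : exists e : R,
    [/\ 0 < e, M * e <= 1 - (c + M * l) & M `^ p * e <= b - I].
  exists (Num.min ((1 - (c + M * l)) / (M + 1)) ((b - I) / (M `^ p + 1))).
  set e := Num.min _ _.
  have e1 : e <= (1 - (c + M * l)) / (M + 1) by rewrite ge_min lexx.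
  have e2 : e <= (b - I) / (M `^ p + 1) by rewrite ge_min lexx orbT.
  have e0 : 0 < e by rewrite lt_min !divr_gt0//; lra.
  split=> //.
    move: e1; rewrite ler_pdivlMr; last lra.
    by move=> h; apply: le_trans h; rewrite mulrC ler_wpM2l ?(ltW e0)//; lra.
  move: e2; rewrite ler_pdivlMr; last lra.
  by move=> h; apply: le_trans h; rewrite mulrC ler_wpM2l ?(ltW e0)//; lra.
have [rla _ _] := hlambda.
have [Q [tQ Q01 muQ laQ]] := indic_real_trig rmu rla mA e0.
have [a [sigma [tsigma Ea]]] := trig_poly_split (trig_polyM t1 tQ).
have ca : c <= complex.Re a.
  apply: le_trans (constant_term_lb ttau tM mA tQ Q01 lA (ltW laQ) tsigma Ea).
  by rewrite mulrDr; lra.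
have cna : c <= normc a by apply: le_trans (le_trans ca (ler_norm _)) (Re_le_normc a).
have a0 : a != 0 by apply/eqP => a0; move: cna; rewrite a0 normc0 leNgt c0.
apply: le_trans (_ : (\int[mu]_g (normc (1 - - a^-1 * sigma g) `^ p)%:E <= _)%E).
  apply: ereal_inf_lbound; exists (fun g => - a^-1 * sigma g) => //.
  exact: trig_polyZ.
have EP g : normc (1 - - a^-1 * sigma g) = normc (1 - tau g) * Q g / normc a.
  have -> : 1 - - a^-1 * sigma g = ((1 - tau g) * (Q g)%:C%C) * a^-1.
    rewrite (congr1 (fun f => f g) Ea) mulNr opprK mulrDl divff//.
    by rewrite [a^-1 * _]mulrC.
  rewrite !normcM normcV; congr (_ * _ / _).
  rewrite /normc/= expr0n addr0 sqrtr_sqr ger0_norm//.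
  by have /andP[] := Q01 g.
have cp0 : 0 < c `^ p by exact: powR_gt0.
have mA1 : measurable_fun setT (fun g => (F g * \1_A g)%:E).
  by apply/measurable_EFinP; apply: measurable_funM => //; exact: measurable_indic.
have mQ : measurable_fun setT Q by exact: real_trig_measurable.
have mAQ : measurable_fun setT (fun g => `|\1_A g - Q g|%:E).
  apply/measurable_EFinP; apply: measurableT_comp => //.
  by apply: measurable_funB => //; exact: measurable_indic.
apply: le_trans (_ : (\int[mu]_g (((c `^ p)^-1)%:E *
   ((F g * \1_A g)%:E + (M `^ p)%:E * `|\1_A g - Q g|%:E)) <= _)%E).
  apply: ge0_le_integral => //.
  - by move=> g _; rewrite lee_fin powR_ge0.
  - apply/measurable_EFinP; apply: (measurableT_comp (measurable_powR p)).
    apply: normc_trig_measurable; apply: trig_polyD; first exact: trig_poly_cst.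
    under eq_fun do rewrite -mulNr opprK.
    by apply: trig_polyZ; exact: trig_poly_sub tsigma.
  - by apply: emeasurable_funM => //; apply: emeasurable_funD => //; exact: emeasurable_funM.
  move=> g _; have /andP[Q0 Q1] := Q01 g.
  rewrite EP.
  apply: (@le_trans _ _ ((c `^ p)^-1 * (F g * \1_A g + M `^ p * `|\1_A g - Q g|))%:E);
    last by rewrite EFinM EFinD EFinM.
  rewrite lee_fin.
  rewrite powRM ?mulr_ge0 ?normc_ge0 ?invr_ge0 ?normc_ge0//.
  rewrite powRM ?normc_ge0// -/(F g) mulrC.
  apply: ler_pM => //.
  - exact: powR_ge0.
  - by rewrite mulr_ge0// powR_ge0.
  - have na0 : 0 < normc a by exact: lt_le_trans cna.
    have nap0 : 0 < normc a `^ p by exact: powR_gt0.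
    have -> : (normc a)^-1 `^ p = (normc a `^ p)^-1.
      apply: (mulIf (lt0r_neq0 nap0)); rewrite mulVf ?lt0r_neq0//.
      by rewrite -powRM ?invr_ge0 ?(ltW na0)// mulVf ?lt0r_neq0// powR1.
    rewrite lef_pV2 ?posrE//.
    by apply: ge0_ler_powR; rewrite ?nnegrE ?normc_ge0// ltW.
  apply: le_trans (_ : F g * Q g <= _).
    by rewrite ler_wpM2l// powR_le_id// Q0.
  have -> : F g * Q g = F g * \1_A g + F g * (Q g - \1_A g) by ring.
  rewrite lerD2l (le_trans (ler_norm _))// normrM distrC ger0_norm//.
  by rewrite ler_wpM2r.
have cp1 : 0 <= (c `^ p)^-1 by rewrite invr_ge0 ltW.
rewrite ge0_integralZl//; last 2 first.
- by apply: emeasurable_funD => //; exact: emeasurable_funM.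
- by move=> g _; rewrite adde_ge0 ?mule_ge0// lee_fin// mulr_ge0.
rewrite mulrC EFinM lee_pmul2l ?lte_fin ?invr_gt0//.
rewrite ge0_integralD//; last 3 first.
- by move=> g _; rewrite lee_fin mulr_ge0.
- by move=> g _; rewrite mule_ge0// lee_fin.
- exact: emeasurable_funM.
rewrite ge0_integralZl//.
have -> : (\int[mu]_g (F g * \1_A g)%:E)%E = I%:E.
  rewrite -IE [RHS]integral_mkcond; apply: eq_integral => g _.
  by rewrite patchE indicE; case: (g \in A); rewrite ?mulr1 ?mulr0.
have -> : b = I + (b - I) by ring.
rewrite EFinD leeD2l// (le_trans (lee_wpmul2l _ (ltW muQ))) ?lee_fin//.
Qed.

End upper_bound.

(** * Absolute continuity and convergence of densities *)

Section finite_measure_sum.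
Context d (T : measurableType d) (R : realType).
Variables nu lambda : {finite_measure set T -> \bar R}.

Definition sum_measure : set T -> \bar R := measure_add nu lambda.

HB.instance Definition _ := Measure.on sum_measure.

Lemma sum_measureE A : (sum_measure A = nu A + lambda A)%E.
Proof. exact: measure_addE. Qed.

Let sum_measure_fin : fin_num_fun sum_measure.
Proof. by move=> A mA; rewrite sum_measureE fin_numD !fin_num_measure. Qed.

HB.instance Definition _ :=
  @Measure_isFinite.Build _ _ _ sum_measure sum_measure_fin.

End finite_measure_sum.

Section absolutely_continuous_part.
Local Open Scope charge_scope.
Context d (T : measurableType d) (R : realType).
Variables nu lambda : {finite_measure set T -> \bar R}.

(** The part of [lambda] that is singular to [nu] lives on a [nu]-null set [N],
    and off [N] absolute continuity holds in its epsilon-delta form. With [f] the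
    density of [nu] with respect to [nu + lambda], take [N] to be the set where
    [f] vanishes: where [f >= 1/(k+1)], [lambda] is at most [(k+1) nu], and the
    sets where [f < 1/(k+1)] decrease to [N]. *)
Lemma abs_continuous_off_null_set : exists N, [/\ measurable N, nu N = 0%E &
  forall e : R, 0 < e -> exists2 r : R, 0 < r & forall B, measurable B ->
    (nu B < r%:E)%E -> (lambda (B `\` N) < e%:E)%E].
Proof.
pose sigma : {finite_measure set T -> \bar R} := sum_measure nu lambda.
have sE A : (sigma A = nu A + lambda A)%E by exact: sum_measureE.
have nus : nu `<< sigma.
  apply/null_content_dominatesP => A mA sA0.
  have /eqP : (nu A + lambda A = 0)%E by rewrite -sE.
  by rewrite padde_eq0// => /andP[/eqP].
pose f := ('d (charge_of_finite_measure nu) '/d sigma).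
have intf : sigma.-integrable setT f by exact: Radon_Nikodym_integrable.
have mf : measurable_fun setT f by exact: measurable_int intf.
have nuE A : measurable A -> nu A = (\int[sigma]_(x in A) f x)%E.
  by move=> mA; rewrite -Radon_Nikodym_integral.
pose N k := [set x | (f x < k.+1%:R^-1%:E)%E].
have mN k : measurable (N k).
  by rewrite -[N k]setTI; apply: emeasurable_fun_infty_o.
have mN0 : measurable (\bigcap_k N k) by exact: bigcap_measurable.
have intfS A : measurable A -> sigma.-integrable A f.
  by move=> mA; apply: integrableS intf.
have icst A (c : R) : measurable A -> sigma.-integrable A (cst c%:E).
  by move=> mA; exact: finite_measure_integrable_cst.
exists (\bigcap_k N k); split=> //.
  apply/eqP; rewrite eq_le measure_ge0 andbT nuE//.
  rewrite -[leRHS](integral0 sigma (\bigcap_k N k)).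
  apply: le_integral => //; [exact: intfS|exact: icst|].
  move=> x; rewrite inE => Nx; apply/lee_addgt0Pr => e e0; rewrite add0e.
  have [k ke] : exists k, k.+1%:R^-1 < e.
    by have [k _ kP] := near_infty_natSinv_lt (PosNum e0); exists k; apply: kP => /=.
  by rewrite ltW// (lt_trans (Nx k I))// lte_fin.
move=> e e0; have e20 : 0 < e / 2 by rewrite divr_gt0.
have Nnoninc : nonincreasing_seq N.
  move=> m n mn; apply/subsetPset => x /= /lt_le_trans; apply.
  by rewrite lee_fin lef_pV2 ?posrE// ler_nat.
have cvN : lambda (N k) @[k --> \oo] --> lambda (\bigcap_k N k).
  by apply: nonincreasing_cvg_mu => //; rewrite -ge0_fin_numE// fin_num_measure.
have [k Nk] : exists k, (lambda (N k `\` \bigcap_k N k) < (e / 2)%:E)%E.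
  have fN : lambda (\bigcap_k N k) \is a fin_num by exact: fin_num_measure.
  have /fine_cvgP[fn cv] : lambda (N k) @[k --> \oo] --> (fine (lambda (\bigcap_k N k)))%:E.
    by rewrite fineK.
  move/cvgrPdist_lt : cv => /(_ _ e20) cv.
  have [k [fk /= Hk]] := filter_ex (filterI fn cv); exists k.
  have key : (lambda (N k) - lambda (\bigcap_k N k) < (e / 2)%:E)%E.
    rewrite -(fineK fk) -(fineK fN) -EFinB lte_fin.
    by rewrite (le_lt_trans _ Hk)// distrC ler_norm.
  rewrite measureD//; last by rewrite -ge0_fin_numE// fin_num_measure.
  by rewrite setIidr//; move=> x; apply.
have k0 : (0 : R) < k.+1%:R^-1 by rewrite invr_gt0.
exists (k.+1%:R^-1 * (e / 2)); first by rewrite mulr_gt0.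
move=> B mB nuB.
have mBN : measurable (B `\` N k) by exact: measurableD.
have laB : (lambda (B `\` N k) < (e / 2)%:E)%E.
  rewrite -(@lte_pmul2l _ k.+1%:R^-1%:E) ?lte_fin//.
  rewrite -EFinM; apply: le_lt_trans nuB.
  apply: le_trans (_ : (nu (B `\` N k) <= _)%E); last first.
    by apply: le_measure; rewrite ?inE//; exact: subDsetl.
  apply: le_trans (_ : (k.+1%:R^-1%:E * sigma (B `\` N k) <= _)%E).
    by rewrite lee_pmul2l ?lte_fin// sE leeDr.
  rewrite -integral_cst// nuE//.
  apply: le_integral => //; [exact: icst|exact: intfS|].
  by move=> x; rewrite inE => -[_ /negP]; rewrite -leNgt.
apply: (@le_lt_trans _ _ (lambda (N k `\` \bigcap_k N k) + lambda (B `\` N k))%E).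
  apply: (@le_trans _ _ (lambda ((N k `\` \bigcap_k N k) `|` (B `\` N k)))).
    apply: le_measure; rewrite ?inE//; [exact: measurableD|
      by apply: measurableU => //; exact: measurableD|].
    move=> x [Bx Nx]; have [|] := pselect (N k x); first by left.
    by right.
  by apply: measureU2 => //; exact: measurableD.
have -> : (e%:E = (e / 2)%:E + (e / 2)%:E)%E by rewrite -EFinD; congr (_%:E); field.
exact: lteD.
Qed.

(** Where the density of [mu] exceeds that of [mu0] by at most [r], integrals
    against [mu] are controlled by integrals against [mu0]. A [nu]-null set [N] of
    exceptions is allowed in [A], since [mu] does not charge it. *)
Lemma truncated_integral_le (mu mu0 : {finite_measure set T -> \bar R})
    (F : T -> R) (A N : set T) (K r : R) :
  mu `<< nu -> mu0 `<< nu -> measurable_fun setT F ->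
  (forall x, 0 <= F x <= K) -> 0 <= r -> measurable A -> measurable N -> nu N = 0%E ->
  (forall x, A x -> ~ N x ->
    ('d (charge_of_finite_measure mu) '/d nu x <=
     'd (charge_of_finite_measure mu0) '/d nu x + r%:E)%E) ->
  (\int[mu]_(x in A) (F x)%:E <= \int[mu0]_x (F x)%:E + (r * K)%:E * nu setT)%E.
Proof.
move=> munu mu0nu mF F0K r0 mA mN N0 hle.
have bF (D : set T) : [bounded F x | x in D].
  exists K; split; first exact: num_real.
  move=> M KM x _ /=; have /andP[F0 FK] := F0K x.
  by rewrite ger0_norm// (le_trans FK)// ltW.
have iF (m : {finite_measure set T -> \bar R}) D : measurable D ->
    m.-integrable D (EFin \o F).
  move=> mD; apply: measurable_bounded_integrable => //.
    by rewrite -ge0_fin_numE// fin_num_measure.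
  exact: measurable_funTS.
have K0 : 0 <= K by have /andP[F0 FK] := F0K point; exact: le_trans FK.
have mAN : measurable (A `\` N) by exact: measurableD.
have muN : mu N = 0%E by move/null_content_dominatesP : munu; apply.
rewrite (negligible_integral mN mA (iF _ _ mA) muN).
rewrite -(Radon_Nikodym_change_of_variables munu mAN (iF _ _ mAN)).
set h := (Radon_Nikodym _ _); set h0 := ('d (charge_of_finite_measure mu0) '/d nu).
have ih : nu.-integrable (A `\` N) h.
  by apply: (integrableS measurableT) => //; exact: Radon_Nikodym_integrable.
have ih0 : nu.-integrable (A `\` N) h0.
  by apply: (integrableS measurableT) => //; exact: Radon_Nikodym_integrable.
have iFh0 : nu.-integrable (A `\` N) (fun x => (F x)%:E * h0 x)%E.
  exact: (integrableMr mAN (measurable_funTS mF) (bF _) ih0).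
have ic : nu.-integrable (A `\` N) (cst (r * K)%:E).
  exact: finite_measure_integrable_cst.
apply: (@le_trans _ _ (\int[nu]_(x in A `\` N) ((F x)%:E * h0 x + (r * K)%:E))%E).
  apply: le_integral => //.
  - exact: (integrableMr mAN (measurable_funTS mF) (bF _) ih).
  - exact: integrableD.
  move=> x; rewrite inE => -[Ax Nx]; have /andP[F0 FK] := F0K x.
  have fh0 : h0 x \is a fin_num by exact: Radon_Nikodym_fin_num.
  apply: le_trans (lee_wpmul2l _ (hle x Ax Nx)) _; first by rewrite lee_fin.
  rewrite -/h0 muleDr ?fin_num_adde_defr// leeD2l// -EFinM lee_fin mulrC.
  by rewrite ler_wpM2l.
rewrite integralD// integral_cst// (Radon_Nikodym_change_of_variables mu0nu mAN (iF _ _ mAN)).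
apply: leeD.
  apply: ge0_subset_integral => //; first exact/measurable_EFinP.
  by move=> x _; rewrite lee_fin; have /andP[] := F0K x.
apply: lee_wpmul2l; first by rewrite lee_fin mulr_ge0.
by apply: le_measure; rewrite ?inE.
Qed.

End absolutely_continuous_part.

(** * Upper semicontinuity of d_p *)

Section limsup_bounds.
Variables (R : realType) (G : zmodType).

Lemma limn_esup_le_near (u : nat -> \bar R) (a : \bar R) :
  (\forall n \near \oo, (u n <= a)%E) -> (limn_esup u <= a)%E.
Proof.
move=> ua; apply: (@le_trans _ _ (ereal_sup (u @` [set n | (u n <= a)%E]))).
  by apply: ereal_inf_lbound; exists [set n | (u n <= a)%E].
by apply: ge_ereal_sup => _ [n /= una <-].
Qed.

Lemma dp_ge0 (p : R) (mu : {finite_measure set (dual R G) -> \bar R}) (S : set G) :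
  (0 <= dp p mu S)%E.
Proof.
apply: le_ereal_inf_tmp => _ [tau _ <-]; apply: integral_ge0 => g _.
by rewrite lee_fin powR_ge0.
Qed.

(** A nonzero [x] that every character sends to 1 makes the constant 1 a member
    of [T(S)]. *)
Lemma dp_trivial_character (p : R) (mu : {finite_measure set (dual R G) -> \bar R})
    (x : G) :
  1 <= p -> x <> 0 -> (forall g : dual R G, echar x g = 1) ->
  (dp p mu [set x : G | x <> 0%R] <= 0)%E.
Proof.
move=> p1 x0 x1; apply: ereal_inf_lbound.
exists (fun g => 1 * echar x g); first exact: trig_poly_monomial.
rewrite -[RHS](integral0 mu setT); apply: eq_integral => g _.
by rewrite x1 mulr1 subrr normc0 powR0// gt_eqF// (lt_le_trans _ p1).
Qed.

(** The truncation for [mu n] removes the set [B] where the densities of [mu n] and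
    [mu0] differ by at least [r], except for its part inside the [nu]-null set
    that carries the [nu]-singular part of [lambda]. What is removed has small
    [nu]-measure, hence small [lambda]-measure; on what is kept, [mu n] is
    dominated by [mu0 + r nu]. *)
Lemma dp_le_eventually (lambda : {finite_measure set (dual R G) -> \bar R})
    (mu0 nu : {finite_measure set (dual R G) -> \bar R})
    (mu : nat -> {finite_measure set (dual R G) -> \bar R})
    (p : R) (tau : dual R G -> R[i]) (e : R) :
  normalized_haar lambda ->
  (forall x : G, x <> 0 -> exists g : dual R G, echar x g <> 1) ->
  (forall n, regular_measure (mu n)) ->
  mu0 `<< nu -> (forall n, mu n `<< nu) ->
  cvg_in_measure nu
    (fun n => Radon_Nikodym (charge_of_finite_measure (mu n)) nu)
    (Radon_Nikodym (charge_of_finite_measure mu0) nu) ->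
  1 <= p -> trig_poly [set x : G | x <> 0] tau -> 0 < e ->
  \forall n \near \oo, (dp p (mu n) [set x : G | x <> 0%R] <=
    \int[mu0]_g ((normc (1 - tau g)) `^ p)%:E + e%:E)%E.
Proof.
move=> hla sep rmu mu0nu munu cvm p1 ttau e0.
have p0 : 0 < p by exact: lt_le_trans p1.
have t1 : trig_poly setT (fun g => 1 - tau g).
  apply: trig_polyD; first exact: trig_poly_cst.
  by under eq_fun do rewrite -mulN1r; apply: trig_polyZ; exact: trig_poly_sub ttau.
have [M M0 tM] := trig_poly_bounded t1.
pose F g := normc (1 - tau g) `^ p.
have mF : measurable_fun setT F.
  by apply: (measurableT_comp (measurable_powR p)); exact: normc_trig_measurable.
have FK g : 0 <= F g <= M `^ p.
  by rewrite powR_ge0 ge0_ler_powR ?nnegrE ?normc_ge0// ltW.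
have Dfin : (\int[mu0]_g (F g)%:E)%E \is a fin_num.
  apply: integrable_fin_num => //; apply: (@bounded_integrable _ _ _ _ _ (M `^ p)) => // g.
  by have /andP[F0 FM] := FK g; rewrite ger0_norm.
pose D := fine (\int[mu0]_g (F g)%:E)%E.
have DE : (\int[mu0]_g (F g)%:E)%E = D%:E by rewrite fineK.
have D0 : 0 <= D.
  by apply/fine_ge0/integral_ge0 => g _; rewrite lee_fin; have /andP[] := FK g.
(* Half of e pays for r; the other half for the normalization, as
   (D + e / 2) / c ^ p = D + e. *)
pose y := (D + e / 2) / (D + e).
have De : 0 < D + e by rewrite ltr_wpDl.
have De2 : 0 < D + e / 2 by rewrite ltr_wpDl// divr_gt0.
have y0 : 0 < y by rewrite divr_gt0.
have y1 : y < 1 by rewrite ltr_pdivrMr// mul1r; lra.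
pose c := y `^ p^-1.
have c0 : 0 < c by exact: powR_gt0.
have cp : c `^ p = y by rewrite -powRrM mulVf ?gt_eqF// powRr1// ltW.
have c1 : c < 1.
  have -> : 1 = 1 `^ p^-1 :> R by rewrite powR1.
  by rewrite gt0_ltr_powR ?invr_gt0// nnegrE ltW.
pose l := (1 - c) / (2 * M).
have l0 : 0 < l by rewrite divr_gt0 ?mulr_gt0 ?subr_gt0.
have cl : c + M * l < 1.
  have -> : M * l = (1 - c) / 2 by rewrite /l; field; rewrite gt_eqF.
  lra.
pose V := fine (nu setT).
have VE : nu setT = V%:E by rewrite fineK// fin_num_measure.
have V0 : 0 <= V by exact: fine_ge0.
pose KV := M `^ p * V.
have KV0 : 0 <= KV by rewrite mulr_ge0// powR_ge0.
pose r := e / (4 * (KV + 1)).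
have r0 : 0 < r by rewrite divr_gt0// mulr_gt0//; lra.
have rKV : r * KV <= e / 4.
  have -> : r * KV = e / 4 * (KV / (KV + 1)) by rewrite /r; field; lra.
  have e40 : 0 <= e / 4 by lra.
  rewrite -[leRHS]mulr1 ler_wpM2l// ler_pdivrMr ?mul1r; lra.
have [N [mN N0 hN]] := abs_continuous_off_null_set nu lambda.
have [s s0 hs] := hN l l0.
have /fine_cvgP[fn cv] := cvm r r0.
move/cvgrPdist_lt : cv => /(_ _ s0); move: fn; apply: filterS2 => n.
set B := [set t | _] => fB; rewrite /= sub0r normrN => Bs.
have {Bs} Bs : (nu B < s%:E)%E.
  by rewrite -(fineK fB) lte_fin (le_lt_trans _ Bs)// ler_norm.
have mh (m : {finite_measure set (dual R G) -> \bar R}) : m `<< nu ->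
    measurable_fun setT (Radon_Nikodym (charge_of_finite_measure m) nu).
  by move=> mnu; apply: measurable_int; exact: Radon_Nikodym_integrable.
have mB : measurable B.
  rewrite -[B]setTI; apply: emeasurable_fun_c_infty => //.
  by apply: measurableT_comp => //; apply: emeasurable_funB; exact: mh.
have mBN : measurable (B `\` N) by exact: measurableD.
have -> : (\int[mu0]_g (normc (1 - tau g) `^ p)%:E + e%:E)%E = ((D + e / 2) / c `^ p)%:E.
  transitivity (D%:E + e%:E)%E; first by rewrite -DE.
  rewrite -EFinD cp; congr EFin; rewrite /y invf_div mulrCA mulfV ?mulr1//.
  by rewrite gt_eqF.
apply: (@dp_le_truncation _ _ lambda hla sep _ tau (~` (B `\` N)) p M c l) => //.
- exact: measurableC.
- by rewrite setCK; apply/ltW/hs.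
- apply: (@le_lt_trans _ _ (D + r * KV)%:E); last first.
    by rewrite lte_fin ltrD2l; lra.
  rewrite EFinD -DE mulrA EFinM -VE.
  apply: (truncated_integral_le (munu n) mu0nu mF FK (ltW r0) (measurableC mBN) mN N0).
  move=> g nBN nN; have {nBN} : ~ B g by move=> Bg; apply: nBN.
  rewrite /B /= => /negP; rewrite -ltNge.
  have /fineK <- : Radon_Nikodym (charge_of_finite_measure (mu n)) nu g \is a fin_num.
    by apply: Radon_Nikodym_fin_num; exact: munu.
  have /fineK <- : Radon_Nikodym (charge_of_finite_measure mu0) nu g \is a fin_num.
    by apply: Radon_Nikodym_fin_num; exact: mu0nu.
  rewrite -EFinB -EFinD lte_fin lee_fin => h.
  by have := le_lt_trans (ler_norm _) h; lra.
Qed.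

End limsup_bounds.

Theorem theorem4p6 (R : realType) (G : zmodType) (hG : exists x : G, x <> 0)
    (lambda : {finite_measure set (dual R G) -> \bar R})
    (hlambda : normalized_haar lambda)
    (mu0 : {finite_measure set (dual R G) -> \bar R})
    (mu : nat -> {finite_measure set (dual R G) -> \bar R})
    (hmu0 : inM mu0) (hmu : forall n, inM (mu n))
    (hac0 : mu0 `<< lambda) (hac : forall n, mu n `<< lambda)
    (hlim : mlim mu mu0) (p : R) (hp : 1 <= p) :
  (limn_esup (fun n => dp p (mu n) [set x : G | x <> 0%R])
     <= dp p mu0 [set x : G | x <> 0%R])%E.
Proof.
have [sep|/existsNP[x /not_implyP[x0 /forallNP x1]]] := pselect
    (forall x : G, x <> 0 -> exists g : dual R G, echar x g <> 1); last first.
  apply: (@le_trans _ _ 0%E); last exact: dp_ge0.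
  apply: limn_esup_le_near; apply: nearW => n.
  by apply: (dp_trivial_character _ hp x0) => g; exact: contrapT (x1 g).
have [nu [_ mu0nu munu cvm]] := hlim.
apply: le_ereal_inf_tmp => _ [tau ttau <-].
apply/lee_addgt0Pr => e e0; apply: limn_esup_le_near.
by apply: (dp_le_eventually hlambda sep _ mu0nu munu cvm) => // n; have [] := hmu n.
Qed.
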